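(* Let $K\ge3$, $N\ge2$, $\theta>0$, $p>0$. The $N$-particle process $(\eta^{(N)}_t)_{t\ge0}$ on $\mathcal{E}_{K,N}$ with generator $\mathcal{L}_{K,N}$ (see context) has the following properties. (a) It is not reversible, except when $K=3$ and $\theta=1$ (in which case it is reversible). (b) Its (unique) stationary distribution $\nu_N$ is invariant by rotations: $\nu_N=\nu_N\circ\phi^{(l)}$ for every $l\in\{1,2,\dots,K-1\}$. (c) For every $k\in\mathbb{Z}/K\mathbb{Z}$, \[ \mathbb{E}_{\nu_N}\left[\frac{\eta(k)}{N}\right]=\frac1K . \] That is, under the stationary distribution the empirical distribution of the particle system is an unbiased estimator of the uniform distribution on $\mathbb{Z}/K\mathbb{Z}$, which is the quasi-stationary distribution of the killed walk on $\mathbb{Z}/K\mathbb{Z}$ jumping $x\to x+1$ at rate $1$, $x\to x-1$ at rate $\theta$, and killed at rate $p$.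
   Context: $\mathcal{E}_{K,N}=\{\eta:\mathbb{Z}/K\mathbb{Z}\to\mathbb{N},\ \sum_{k=0}^{K-1}\eta(k)=N\}$ ($\mathbb{N}$ includes $0$). The generator is \[ (\mathcal{L}_{K,N}f)(\eta)=\sum_{i,j\in\mathbb{Z}/K\mathbb{Z}}\eta(i)\left(\mathbf{1}_{\{j=i+1\}}+\theta\,\mathbf{1}_{\{j=i-1\}}+p\frac{\eta(j)}{N-1}\right)[f(T_{i\to j}\eta)-f(\eta)], \] where $T_{i\to j}\eta=\eta-\mathbf{e}_i+\mathbf{e}_j$ (defined when $\eta(i)>0$) and $\mathbf{e}_i$ is the $i$-th canonical vector of $\mathbb{R}^K$. The process is irreducible, with unique stationary distribution $\nu_N$. The rotation $\phi:\mathcal{E}_{K,N}\to\mathcal{E}_{K,N}$ is $\phi(\eta_0,\eta_1,\dots,\eta_{K-1})=(\eta_1,\dots,\eta_{K-1},\eta_0)$, $\phi^{(l)}$ is its $l$-fold composition, and $(\nu_N\circ\phi^{(l)})(\eta)=\nu_N(\phi^{(l)}(\eta))$. *)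

(* Defs.v *)
From HB Require Import structures.
From mathcomp Require Import all_boot all_order all_algebra.
From mathcomp Require Import all_classical all_reals all_analysis.

Set Implicit Arguments.
Unset Strict Implicit.
Unset Printing Implicit Defensive.

Import Order.TTheory GRing.Theory Num.Theory.
Import numFieldNormedType.Exports.

Local Open Scope ring_scope.

Section FiniteMarkov.
Variables (R : realType) (S : finType).
Implicit Types (L : (S -> R) -> S -> R) (nu f g : S -> R) (t : R).

Definition is_law nu :=
  (forall x, 0 <= nu x) /\ \sum_x nu x = 1.

Definition mean nu f : R := \sum_x nu x * f x.

(* P_t f (x) = E_x[f(X_t)] for the Markov process X with generator L, i.e.
   P_t = exp(t L).  The state space is finite, so L is a bounded operator and
   the exponential series converges at every point. *)
Definition semigroup L t f (x : S) : R :=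
  limn (series (fun k => t ^+ k / k`!%:R * iter k L f x)).

Definition stationary L nu :=
  is_law nu /\
  forall t f, 0 <= t -> mean nu (semigroup L t f) = mean nu f.

(* P_t is self-adjoint in L^2(nu) for every t; taking f = 1 shows that such a
   nu is stationary. *)
Definition reversible L :=
  exists nu, is_law nu /\
    forall t f g, 0 <= t ->
      mean nu (fun x => f x * semigroup L t g x) =
      mean nu (fun x => g x * semigroup L t f x).

End FiniteMarkov.

(* L generates a process on S plus a cemetery [None]: the law of X_t
   conditioned on survival up to t, when X_0 has law mu, is again mu. *)
Definition quasi_stationary (R : realType) (S : finType)
    (L : (option S -> R) -> option S -> R) (mu : S -> R) :=
  is_law mu /\
  forall t x, 0 <= t ->
    mean mu (fun y => semigroup L t (fun z => (z == Some x)%:R) (Some y))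
      / mean mu (fun y => semigroup L t (fun z => (z != None)%:R) (Some y))
    = mu x.

Definition uniform_law (R : realType) (K : nat) : 'Z_K -> R := fun=> K%:R^-1.

Definition killed_walk (R : realType) (K : nat) (theta p : R)
    (f : option 'Z_K -> R) (x : option 'Z_K) : R :=
  if x is Some i then
    (f (Some (i + 1)) - f (Some i)) + theta * (f (Some (i - 1)) - f (Some i))
    + p * (f None - f (Some i))
  else 0.

(* 'Z_K is Z/KZ when 1 < K. *)
Record conf (K N : nat) := Conf {
  occupation :> {ffun 'Z_K -> nat};
  occupation_sum : (\sum_k occupation k == N)%N
}.

Section ConfFinite.
Variables K N : nat.

HB.instance Definition _ := [isSub for @occupation K N].
HB.instance Definition _ := [Countable of conf K N by <:].

Lemma conf_le (eta : conf K N) k : (eta k < N.+1)%N.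
Proof.
rewrite ltnS -[X in (_ <= X)%N](eqP (occupation_sum eta)).
by rewrite (bigD1 k) //= leq_addr.
Qed.

Definition conf_code (eta : conf K N) : {ffun 'Z_K -> 'I_N.+1} :=
  [ffun k => Ordinal (conf_le eta k)].

Definition conf_decode (c : {ffun 'Z_K -> 'I_N.+1}) : option (conf K N) :=
  insub [ffun k => c k : nat].

Lemma conf_codeK : pcancel conf_code conf_decode.
Proof.
move=> eta; rewrite /conf_decode.
have -> : [ffun k => conf_code eta k : nat] = val eta.
  by apply/ffunP => k; rewrite !ffunE.
exact: valK.
Qed.

HB.instance Definition _ := fintype.isFinite.Build (conf K N) (pcan_enumP conf_codeK).

End ConfFinite.

Section FlemingViot.
Variables (R : realType) (K N : nat).
Implicit Type eta : conf K N.

Definition jump_fun (i j : 'Z_K) eta : {ffun 'Z_K -> nat} :=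
  [ffun k => (eta k - (k == i) + (k == j))%N].

(* T_{i -> j}; the junk value when eta i = 0 is eta. *)
Definition jump (i j : 'Z_K) eta : conf K N := insubd eta (jump_fun i j eta).

Lemma jumpE (i j : 'Z_K) eta : (0 < eta i)%N ->
  forall k, jump i j eta k = (eta k - (k == i) + (k == j))%N.
Proof.
move=> eta_i k; rewrite /jump -[occupation _]/(val _) val_insubd ifT ?ffunE //.
rewrite (eq_bigr (fun k => (eta k - (k == i) + (k == j))%N)); last first.
  by move=> l _; rewrite ffunE.
have sum1 (l : 'Z_K) : (\sum_(k : 'Z_K) (k == l) = 1)%N.
  by rewrite (bigD1 l) //= eqxx big1 // => m /negPf ->.
rewrite big_split /= sumnB => [|l _]; last by case: eqP => // ->.
rewrite !sum1 subnK; first exact: occupation_sum.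
by rewrite (bigD1 i) //= ltn_addr.
Qed.

Definition generator (theta p : R) (f : conf K N -> R) eta : R :=
  \sum_(i : 'Z_K) \sum_(j : 'Z_K)
    (eta i)%:R *
    ((j == i + 1)%:R + theta * (j == i - 1)%:R + p * ((eta j)%:R / (N%:R - 1))) *
    (f (jump i j eta) - f eta).

Lemma rotation_subproof eta : (\sum_k [ffun k : 'Z_K => eta (k + 1)%R] k == N)%N.
Proof.
rewrite -[X in _ == X](eqP (occupation_sum eta)); apply/eqP.
rewrite [RHS](reindex_inj (addIr (1 : 'Z_K))) /=.
by apply: eq_bigr => k _; rewrite ffunE.
Qed.

Definition rotation eta : conf K N := Conf (rotation_subproof eta).

Definition empirical eta (k : 'Z_K) : R := (eta k)%:R / N%:R.

End FlemingViot.

(* Main.v *)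
Require Import Defs.
From mathcomp Require Import all_boot all_order all_algebra.
From mathcomp Require Import all_classical all_reals all_analysis.
From mathcomp Require Import ring lra zify.

Set Implicit Arguments.
Unset Strict Implicit.
Unset Printing Implicit Defensive.

Import Order.TTheory GRing.Theory Num.Theory.
Import numFieldNormedType.Exports.

Local Open Scope ring_scope.

(** Every claim about the semigroups [exp (t L)] is first turned into linear
algebra about [L].  For a bounded [L], a weighted sum of values of
[exp (t L) f] is the series [\sum_k t ^+ k / k`! * a k] whose coefficients
[a k], the same weighted sum of [L^k f], grow at most geometrically.  If two
such series agree for all [t >= 0], their coefficients of [t] agree
([egf_coef1]).  Hence a law is stationary iff it satisfies the balance of
flows ([stationaryP]), [L] is reversible iff some law satisfies detailed
balance ([reversibleP]), and a law of the killed walk is quasi-stationary iff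
it is balanced for the walk without killing
([quasi_stationary_balanced]): all sites die at the same rate [p], so dying
multiplies everything by [expR (- p t)].

On a finite irreducible chain a balanced law exists because the generator
matrix kills constants, hence is singular, and the absolute value of a
balanced weight is balanced ([exists_balanced_law], [balanced_norm]).  It is
unique because a nonnegative balanced weight that vanishes somewhere vanishes
everywhere ([balanced_eq0], [balanced_law_unique]).  The particle system is
irreducible: jumping one step down repeatedly brings all particles to the site
0, and each such jump can be undone ([fv_irreducible]).

(a) Detailed balance fails on explicit configurations.  Let [c] have all the
particles at 0.  If [K >= 4], no particle can go from the site 0 to the empty
site 2, while a particle alone at 2 joins the others at 0 at rate [p]; so
detailed balance would give weight 0 to a state of positive stationary weight
([detailed_balance_eq3]).  If [K = 3], a single particle travelling
0, 1, 2, 0 while the others stay at 0 gives a cycle of three configurations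
whose rates multiply to [N (1 + p)] in one direction and to
[N theta^2 (theta + p)] in the other; these are equal only for [theta = 1]
([detailed_balance_theta1]).  Conversely, for [K = 3] and [theta = 1] a
particle moves between any two distinct sites at rate
[1 + p * eta j / (N - 1)], which depends only on the occupation [eta j] of the
target; such dynamics has a reversible product weight ([fv_reversible]).

(b) The rates commute with the rotation, so composing the stationary law with
the rotation gives a stationary law, and uniqueness applies.

(c) By (b) the mean occupations of all sites are equal, and they add up to
[N] ([rotation_invariant_mean]).

The uniform law is balanced for the walk on the cycle, which is irreducible,
so it is the only quasi-stationary law. *)

(** * Exponential series with geometrically growing coefficients *)

Section ExponentialSeries.
Variable R : realType.
Implicit Types (a b : nat -> R) (t C M : R).

Definition egf_term t a : nat -> R := fun k => t ^+ k / k`!%:R * a k.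

(** [semigroup L t f x] is convertible to [egf (fun k => iter k L f x) t]. *)
Definition egf a t : R := limn (series (egf_term t a)).

Definition geometric_growth a :=
  exists C M, [/\ 0 <= C, 0 <= M & forall k, `|a k| <= C * M ^+ k].

Lemma geometric_growthB a b : geometric_growth a -> geometric_growth b ->
  geometric_growth (fun k => a k - b k).
Proof.
move=> [C [M [C0 M0 aM]]] [D [Q [D0 Q0 bQ]]].
exists (C + D), (M + Q); split; [exact: addr_ge0 | exact: addr_ge0 |] => k.
apply: le_trans (ler_normB _ _) _; rewrite mulrDl.
apply: lerD; [apply: le_trans (aM k) _ | apply: le_trans (bQ k) _];
  by apply: ler_wpM2l => //; apply: lerXn2r; rewrite ?nnegrE ?addr_ge0 // ?lerDl ?lerDr.
Qed.

Lemma geometric_growthX m c : geometric_growth (fun k => m ^+ k * c).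
Proof.
exists `|c|, `|m|; split => // k.
by rewrite normrM normrX mulrC.
Qed.

Lemma geometric_growth_sum (I : finType) (w : I -> R) (a : I -> nat -> R) :
  (forall i, geometric_growth (a i)) ->
  geometric_growth (fun k => \sum_i w i * a i k).
Proof.
move=> ga; rewrite /index_enum; elim: (Finite.enum I) => [|i s IH].
  exists 0, 0; split => // k; by rewrite big_nil normr0 mul0r.
have [C [M [C0 M0 aM]]] := ga i.
have gi : geometric_growth (fun k => - (w i * a i k)).
  exists (`|w i| * C), M; split => //; first exact: mulr_ge0.
  by move=> k; rewrite normrN normrM -mulrA ler_wpM2l.
have [D [Q [D0 Q0 bQ]]] := geometric_growthB IH gi.
by exists D, Q; split => // k; rewrite big_cons addrC -[X in _ + X]opprK.
Qed.

Lemma is_cvg_egf a t : geometric_growth a -> cvgn (series (egf_term t a)).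
Proof.
move=> [C [M [C0 M0 aM]]]; apply: normed_cvg.
apply: (@series_le_cvg _ _ (C *: exp_coeff (`|t| * M))) => [n|n|n|].
- exact: normr_ge0.
- by rewrite mulr_ge0 // exp_coeff_ge0 // mulr_ge0.
- change (`|egf_term t a n| <= C * ((`|t| * M) ^+ n / n`!%:R)); rewrite /egf_term.
  rewrite !normrM normrX normfV (ger0_norm (ler0n _ _)) exprMn.
  rewrite [leRHS](_ : _ = `|t| ^+ n / n`!%:R * (C * M ^+ n)); last by ring.
  by rewrite ler_wpM2l // mulr_ge0 // ?invr_ge0 // exprn_ge0.
- exact/is_cvg_seriesZ/is_cvg_series_exp_coeff.
Qed.

Lemma egfB a b t : geometric_growth a -> geometric_growth b ->
  egf (fun k => a k - b k) t = egf a t - egf b t.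
Proof.
move=> ga gb; rewrite /egf -lim_seriesB; [|exact: is_cvg_egf..].
by congr (limn (series _)); apply/funext => k; rewrite /egf_term mulrBr.
Qed.

Lemma egf_sum (I : finType) (w : I -> R) (a : I -> nat -> R) t :
  (forall i, geometric_growth (a i)) ->
  \sum_i w i * egf (a i) t = egf (fun k => \sum_i w i * a i k) t.
Proof.
move=> ga; apply/esym/cvg_lim => //.
rewrite (_ : series _ =
  (fun n => \sum_i w i * series (egf_term t (a i)) n)); last first.
  apply/funext => n; rewrite /series /=.
  under [RHS]eq_bigr do rewrite mulr_sumr.
  rewrite exchange_big /=; apply: eq_bigr => k _.
  by rewrite /egf_term mulr_sumr; apply: eq_bigr => i _; rewrite mulrCA.
apply: (cvg_big add_continuous) => i _.
apply: cvgM; first exact: cvg_cst.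
exact: is_cvg_egf.
Qed.

(** With [m = 0] the series is the constant [c]. *)
Lemma egfX m c t : egf (fun k => m ^+ k * c) t = expR (t * m) * c.
Proof.
rewrite /egf /expR mulrC -[RHS]lim_seriesZ; last exact: is_cvg_series_exp_coeff.
congr (limn (series _)); apply/funext => k.
change (egf_term t (fun k => m ^+ k * c) k = c * ((t * m) ^+ k / k`!%:R)).
by rewrite /egf_term exprMn; ring.
Qed.

(** The remainder after the linear term is at most [t ^+ 2] times a constant,
so dividing by [t] and letting [t] tend to [0] isolates the coefficient. *)
Lemma egf_eq0_coef1 a : geometric_growth a ->
  (forall t, 0 <= t -> egf a t = 0) -> a 1%N = 0.
Proof.
move=> ga a_0; have [C [M [C0 M0 aM]]] := ga.
pose B := C * expR M.
have exp_le n : series (exp_coeff M) n <= expR M.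
  apply: nondecreasing_cvgn_le; last exact: is_cvg_series_exp_coeff.
  apply/nondecreasing_seqP => m; rewrite seriesSr lerDl.
  exact: exp_coeff_ge0.
have B0 : 0 <= B by rewrite mulr_ge0 // expR_ge0.
have main t : 0 <= t <= 1 -> `|a 0%N + t * a 1%N| <= t ^+ 2 * B.
  move=> /andP[t0 t1].
  have lim0 : (series (egf_term t a) @ \oo --> (0 : R))%classic.
    by rewrite -(a_0 t t0); exact: is_cvg_egf.
  have lim1 : ((fun n => `|series (egf_term t a) n - (a 0%N + t * a 1%N)|)
      @ \oo --> `|0 - (a 0%N + t * a 1%N)|)%classic.
    by apply: cvg_norm; apply: cvgB => //; exact: cvg_cst.
  rewrite -normrN -[X in `|X| <= _]add0r; apply: (cvgr_to_le lim1).
  near=> n.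
  have [m ->] : exists m, n = m.+2.
    by exists (n - 2)%N; rewrite -addn2 subnK //; near: n; exists 2%N.
  rewrite /series /= 2?big_nat_recl //= /egf_term /= expr0 expr1 !fact0 !divr1 !mul1r.
  rewrite addrA [X in `|X|]addrC addKr.
  apply: le_trans (ler_norm_sum _ _ _) _.
  have -> : t ^+ 2 * B = t ^+ 2 * C * expR M by rewrite /B; ring.
  apply: le_trans (ler_wpM2l _ (exp_le m.+2)); last by rewrite mulr_ge0 ?exprn_ge0.
  rewrite /series /= 2?big_nat_recl //= 2!mulrDr.
  rewrite mulr_sumr addrA; apply: ler_wpDl.
    by rewrite addr_ge0 // !mulr_ge0 ?exprn_ge0 ?exp_coeff_ge0.
  apply: ler_sum => k _.
  rewrite normrM ger0_norm; last by rewrite mulr_ge0 ?exprn_ge0 ?invr_ge0.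
  rewrite /exp_coeff /= [leRHS](_ : _ = t ^+ 2 / k.+2`!%:R * (C * M ^+ k.+2)); last by ring.
  apply: ler_pM; rewrite ?normr_ge0 //.
    by rewrite mulr_ge0 ?exprn_ge0 ?invr_ge0.
  rewrite ler_wpM2r ?invr_ge0 //.
  exact: ler_wiXn2l.
have a00 : a 0%N = 0.
  have := main 0; rewrite lexx ler01 => /(_ isT).
  by rewrite mul0r addr0 expr0n mul0r normr_le0 => /eqP.
apply/eqP; rewrite -normr_le0; apply/ler_addgt0Pr => e e0; rewrite add0r.
(* The divisor is [B + 1] because [B] may be [0]. *)
pose t := Num.min 1 (e / (B + 1)).
have B1 : 0 < B + 1 by rewrite ltr_wpDl.
have t0 : 0 < t by rewrite lt_min ltr01 divr_gt0.
have t1 : t <= 1 by rewrite ge_min lexx.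
have te : t * B <= e.
  have : t <= e / (B + 1) by rewrite ge_min lexx orbT.
  by rewrite ler_pdivlMr // => ?; nra.
have := main t; rewrite (ltW t0) t1 a00 add0r normrM (gtr0_norm t0) => /(_ isT).
by rewrite expr2 -mulrA ler_pM2l // => /le_trans; apply.
Unshelve. all: by end_near.
Qed.

Lemma egf_coef1 a b : geometric_growth a -> geometric_growth b ->
  (forall t, 0 <= t -> egf a t = egf b t) -> a 1%N = b 1%N.
Proof.
move=> ga gb ab; apply/eqP; rewrite -subr_eq0; apply/eqP.
apply: (egf_eq0_coef1 (geometric_growthB ga gb)) => t t0.
by rewrite egfB // ab // subrr.
Qed.

End ExponentialSeries.

(** * Finite continuous-time Markov chains *)

Lemma sum_delta (R : realType) (S : finType) (a : S) (F : S -> R) :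
  \sum_x (a == x)%:R * F x = F a.
Proof.
rewrite (bigD1 a) //= eqxx mul1r big1 ?addr0 // => x.
by rewrite eq_sym => /negPf->; rewrite mul0r.
Qed.

Section JumpChains.
Variables (R : realType) (S : finType).
Implicit Types (q : S -> S -> R) (v nu f g : S -> R).

(** The diagonal of [q] may be positive: a jump from [x] to [x] changes nothing.
The particle system has such jumps, from a site to itself. *)
Definition jump_generator q f (x : S) : R := \sum_y q x y * (f y - f x).

Definition balanced q v :=
  forall y, \sum_x v x * q x y = v y * \sum_z q y z.

(** Applied to the set of the states from which a given state can be reached,
this says that any state can be reached from any other. *)
Definition irreducible q :=
  forall P : S -> Prop, (exists x, P x) ->
    (forall x y, 0 < q x y -> P y -> P x) -> forall x, P x.

Definition detailed_balance q nu := forall x y, nu x * q x y = nu y * q y x.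

(** The state space is finite, so [jump_generator q] is bounded in the sup norm
by twice the sum of all rates. *)
Lemma geometric_growth_iter q f x :
  geometric_growth (fun k => iter k (jump_generator q) f x).
Proof.
pose M := \sum_x \sum_y `|q x y| * 2.
have M0 : 0 <= M by apply: sumr_ge0 => y _; apply: sumr_ge0 => z _; rewrite mulr_ge0.
exists (\sum_x `|f x|), M; split => //; first exact: sumr_ge0.
move=> k; elim: k x => [|k IH] x.
  by rewrite expr0 mulr1 (bigD1 x) //= lerDl sumr_ge0.
rewrite iterS {1}/jump_generator; set g := iter k _ f in IH *.
rewrite exprS mulrCA; set C := _ * M ^+ k in IH *.
have C0 : 0 <= C := le_trans (normr_ge0 _) (IH x).
apply: (@le_trans _ _ (\sum_y `|q x y| * 2 * C)); last first.
  rewrite -mulr_suml ler_wpM2r // /M [leRHS](bigD1 x) //= lerDl.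
  by apply: sumr_ge0 => y _; apply: sumr_ge0 => z _; rewrite mulr_ge0.
apply: le_trans (ler_norm_sum _ _ _) _; apply: ler_sum => y _.
rewrite normrM -mulrA ler_wpM2l // mulr_natl mulr2n.
by apply: le_trans (ler_normB _ _) (lerD _ _).
Qed.

Lemma mean_semigroup q nu f t :
  mean nu (semigroup (jump_generator q) t f) =
  egf (fun k => mean nu (iter k (jump_generator q) f)) t.
Proof.
exact: (egf_sum nu t (fun x => geometric_growth_iter q f x)).
Qed.

(** The transpose of the generator: the coefficient of [f y] is the flow into
[y] minus the flow out of [y]. *)
Lemma mean_jump_generator q v f :
  mean v (jump_generator q f) =
  \sum_y (\sum_x v x * q x y - v y * \sum_z q y z) * f y.
Proof.
transitivity (\sum_x \sum_y v x * q x y * f y - \sum_x v x * (\sum_y q x y) * f x).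
  rewrite -sumrB; apply: eq_bigr => x _.
  rewrite /jump_generator !mulr_sumr mulr_suml -sumrB.
  by apply: eq_bigr => y _; ring.
rewrite exchange_big -sumrB /=; apply: eq_bigr => y _.
by rewrite mulrBl mulr_suml.
Qed.

Lemma balanced_indicator q v :
  (forall y, mean v (jump_generator q (fun x => (x == y)%:R)) = 0) -> balanced q v.
Proof.
move=> inv y; have := inv y.
rewrite mean_jump_generator (bigD1 y) //= eqxx mulr1 [X in _ + X]big1 => [|x /negPf->].
  by rewrite addr0 => /eqP; rewrite subr_eq0 => /eqP.
by rewrite mulr0.
Qed.

Lemma balancedP q v : balanced q v <-> forall f, mean v (jump_generator q f) = 0.
Proof.
split=> [bal f|inv]; last by apply: balanced_indicator => y; exact: inv.
by rewrite mean_jump_generator big1 // => y _; rewrite bal subrr mul0r.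
Qed.

(** Stationarity compares the series with coefficients [mean nu (L^k f)] with
the constant [mean nu f]; the coefficient of [t] gives [mean nu (L f) = 0],
and this makes all the later coefficients vanish too. *)
Lemma stationaryP q nu :
  stationary (jump_generator q) nu <-> is_law nu /\ balanced q nu.
Proof.
split=> -[law inv]; split => //.
  apply/balancedP => f.
  rewrite -[RHS](mul0r (mean nu f)) -[X in _ = X * _](expr1 0).
  apply: (@egf_coef1 _ (fun k => mean nu (iter k (jump_generator q) f))
            (fun k => 0 ^+ k * mean nu f)).
  - exact: (geometric_growth_sum nu (geometric_growth_iter q f)).
  - exact: geometric_growthX.
  - by move=> t t0; rewrite -mean_semigroup inv // egfX mulr0 expR0 mul1r.
move=> t f t0; rewrite mean_semigroup.
rewrite (_ : (fun k => _) = (fun k => 0 ^+ k * mean nu f)); last first.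
  apply/funext => -[|k]; first by rewrite expr0 mul1r.
  by rewrite exprS !mul0r iterS; exact: (balancedP q nu).1 inv _.
by rewrite egfX mulr0 expR0 mul1r.
Qed.

Lemma detailed_balance_self_adjoint q nu f g : detailed_balance q nu ->
  mean nu (fun x => f x * jump_generator q g x) =
  mean nu (fun x => g x * jump_generator q f x).
Proof.
move=> db; rewrite /mean /jump_generator.
(* Both sides are [E f g - D] up to exchanging [f] and [g]: [D] is symmetric by
   commutativity, and [E] by detailed balance. *)
pose E (h k : S -> R) := \sum_x \sum_y nu x * q x y * (h x * k y).
pose D := \sum_x \sum_y nu x * q x y * (f x * g x).
have split_sum h k : (\sum_x \sum_y nu x * q x y * (h x * k x) = D) ->
    \sum_x nu x * (h x * \sum_y q x y * (k y - k x)) = E h k - D.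
  move=> <-; rewrite /E -sumrB; apply: eq_bigr => x _.
  rewrite -sumrB !mulr_sumr; apply: eq_bigr => y _; ring.
rewrite !split_sum //; last first.
  by apply: eq_bigr => x _; apply: eq_bigr => y _; rewrite [g x * _]mulrC.
congr (_ - _); rewrite /E exchange_big /=.
by apply: eq_bigr => x _; apply: eq_bigr => y _; rewrite db [f y * _]mulrC.
Qed.

(** Testing self-adjointness at order one in [t] on the indicators of two
distinct states is exactly detailed balance between them. *)
Lemma reversibleP q :
  reversible (jump_generator q) <-> exists nu, is_law nu /\ detailed_balance q nu.
Proof.
have mulE nu f g t : mean nu (fun x => f x * semigroup (jump_generator q) t g x) =
    egf (fun k => mean nu (fun x => f x * iter k (jump_generator q) g x)) t.
  rewrite [RHS](_ : _ = egf (fun k =>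
    \sum_x (nu x * f x) * iter k (jump_generator q) g x) t); last first.
    by congr (egf _ t); apply/funext => k; apply: eq_bigr => x _; rewrite mulrA.
  rewrite -(egf_sum _ _ (fun x => geometric_growth_iter q g x)).
  by apply: eq_bigr => x _; rewrite mulrA.
have growth nu f g : geometric_growth
    (fun k => mean nu (fun x => f x * iter k (jump_generator q) g x)).
  have := geometric_growth_sum (fun x => nu x * f x) (geometric_growth_iter q g).
  congr geometric_growth; apply/funext => k.
  by apply: eq_bigr => x _; rewrite mulrA.
split=> -[nu [law sym]]; exists nu; split => //.
  move=> x y; have [->//|xy] := eqVneq x y.
  have delta (h : S -> R) z : mean nu (fun w => (w == z)%:R * h w) = nu z * h z.
    rewrite /mean (bigD1 z) //= eqxx mul1r big1 ?addr0 // => w /negPf->.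
    by rewrite mul0r mulr0.
  have gen z w : z != w -> jump_generator q (fun u => (u == w)%:R) z = q z w.
    move=> zw; rewrite /jump_generator (negPf zw) (bigD1 w) //= eqxx subr0 mulr1.
    by rewrite big1 ?addr0 // => u /negPf->; rewrite subrr mulr0.
  rewrite -(gen x y) // -(gen y x) 1?eq_sym // -!delta.
  apply: (egf_coef1 (growth nu _ _) (growth nu _ _)) => t t0.
  by rewrite -!mulE sym.
move=> t f g t0; rewrite !mulE; congr (egf _ t); apply/funext => k.
elim: k f g => [|k IH] f g.
  by apply: eq_bigr => x _; rewrite [f x * _]mulrC.
rewrite iterS detailed_balance_self_adjoint // iterSr -IH.
by apply: eq_bigr => x _; rewrite [X in _ * X]mulrC.
Qed.

Lemma detailed_balance_balanced q nu : detailed_balance q nu -> balanced q nu.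
Proof.
by move=> db y; rewrite mulr_sumr; apply: eq_bigr => x _; exact: db.
Qed.

(** By the triangle inequality the flow of [`|v|] into each state is at least
the flow out of it; summed over all states both flows are equal, so equality
holds at each state. *)
Lemma balanced_norm q v : (forall x y, 0 <= q x y) ->
  balanced q v -> balanced q (fun x => `|v x|).
Proof.
move=> q0 bal y.
pose d y := \sum_x `|v x| * q x y - `|v y| * \sum_z q y z.
have d_ge0 z : 0 <= d z.
  have out0 : 0 <= \sum_w q z w by apply: sumr_ge0.
  rewrite subr_ge0 -{1}(ger0_norm out0) -normrM -bal.
  apply: le_trans (ler_norm_sum _ _ _) _; apply: ler_sum => x _.
  by rewrite normrM (ger0_norm (q0 _ _)).
have d_sum : \sum_z d z = 0.
  rewrite sumrB exchange_big /= -sumrB big1 // => x _.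
  by rewrite -mulr_sumr subrr.
have /eqP := psumr_eq0P (fun z _ => d_ge0 z) d_sum (erefl : true = true) (i := y).
by rewrite subr_eq0 => /eqP.
Qed.

(** If [v y = 0] there is no flow into [y], so [v] vanishes at each state that
can jump to [y]. *)
Lemma balanced_eq0 q v x0 : (forall x y, 0 <= q x y) -> irreducible q ->
  (forall x, 0 <= v x) -> balanced q v -> v x0 = 0 -> forall x, v x = 0.
Proof.
move=> q0 irr v0 bal vx0; apply: irr; first by exists x0.
move=> x y qxy vy; have := bal y; rewrite vy mul0r => sum0.
have /eqP := psumr_eq0P (fun z _ => mulr_ge0 (v0 z) (q0 z y)) sum0
  (erefl : true = true) (i := x).
by rewrite mulf_eq0 (gt_eqF qxy) orbF => /eqP.
Qed.

(** The difference [v] of two balanced laws has sum 0, so it is nonpositive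
somewhere.  Its positive part, here doubled as [`|v| + v], is then a
nonnegative balanced weight with a zero, so [v <= 0] everywhere, and the sum
forces [v = 0]. *)
Lemma balanced_law_unique q nu nu' : (forall x y, 0 <= q x y) -> irreducible q ->
  is_law nu -> balanced q nu -> is_law nu' -> balanced q nu' -> nu =1 nu'.
Proof.
move=> q0 irr [_ s1] bal [_ s1'] bal' x0.
pose v x := nu x - nu' x.
have sum_v : \sum_x v x = 0 by rewrite sumrB s1 s1' subrr.
have bal_v : balanced q v.
  move=> y; rewrite mulrBl -bal -bal' -sumrB.
  by apply: eq_bigr => x _; rewrite mulrBl.
have bal_pos : balanced q (fun x => `|v x| + v x).
  move=> y; rewrite mulrDl -bal_v -(balanced_norm q0 bal_v) -big_split /=.
  by apply: eq_bigr => x _; rewrite mulrDl.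
have pos_ge0 x : 0 <= `|v x| + v x by have := ler_norm (- v x); rewrite normrN; lra.
have [x vx] : exists x, v x <= 0.
  apply/not_existsP => v_gt0.
  have : 0 < \sum_x v x; last by rewrite sum_v ltxx.
  rewrite (bigD1 x0) //= ltr_pwDl //; first by rewrite ltNge; apply/negP.
  by apply: sumr_ge0 => y _; rewrite ltW // ltNge; apply/negP.
have pos0 := balanced_eq0 (x0 := x) q0 irr pos_ge0 bal_pos.
have v_le0 y : 0 <= - v y.
  have -> : - v y = `|v y|; last by [].
  by apply/eqP; rewrite -subr_eq0 -opprD oppr_eq0 addrC pos0 // ler0_norm // addNr.
have /eqP := psumr_eq0P (F := fun y => - v y) (fun y _ => v_le0 y)
  (etrans (sumrN _ _ _) (etrans (congr1 _ sum_v) (oppr0 _))) (erefl : true = true) (i := x0).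
by rewrite oppr_eq0 subr_eq0 => /eqP.
Qed.

(** The generator matrix [A] sends the constant vector 1 to 0, so it also has a
nonzero vector [v] in its left kernel; the normalized [`|v|] is the law. *)
Lemma exists_balanced_law q (x0 : S) : (forall x y, 0 <= q x y) ->
  exists nu, is_law nu /\ balanced q nu.
Proof.
move=> q0.
pose A : 'M[R]_#|S| := \matrix_(i, j) (q (enum_val i) (enum_val j)
  - (i == j)%:R * \sum_z q (enum_val i) z).
have A1 : A *m const_mx (1 : R) = (0 : 'cV_#|S|).
  apply/matrixP => i j; rewrite !mxE.
  under eq_bigr do rewrite !mxE mulr1.
  rewrite sumrB -mulr_suml [X in _ - X * _](bigD1 i) //= eqxx.
  rewrite [X in true%:R + X]big1 => [|k]; last first.
    by rewrite eq_sym => /negPf->.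
  by rewrite addr0 mul1r -(big_enum_val (q (enum_val i))) subrr.
have /eqP/det0P[v v0 vA] : \det A = 0.
  apply/eqP; apply/negPn/negP => detA.
  have := mulKmx (_ : A \in unitmx) (const_mx (1 : R) : 'cV_#|S|).
  rewrite unitmxE unitfE A1 mulmx0 => /(_ detA)/matrixP/(_ (enum_rank x0) ord0).
  by rewrite !mxE => /eqP; rewrite eq_sym oner_eq0.
pose w x := v ord0 (enum_rank x).
have bal : balanced q w.
  move=> y; have /matrixP/(_ ord0 (enum_rank y)) := vA; rewrite !mxE.
  under eq_bigr do rewrite !mxE enum_rankK mulrBr.
  rewrite sumrB => /eqP; rewrite subr_eq0 => /eqP E.
  rewrite (reindex_onto enum_val enum_rank) /=; last by move=> i _; rewrite enum_rankK.
  rewrite (eq_bigl xpredT); last by move=> i; rewrite enum_valK eqxx.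
  under eq_bigr do rewrite /w enum_valK.
  rewrite E (bigD1 (enum_rank y)) //= eqxx enum_rankK mul1r [X in _ + X]big1 ?addr0 //.
  by move=> i /negPf->; rewrite mul0r mulr0.
have sum_gt0 : 0 < \sum_x `|w x|.
  have [i vi] : exists i, v ord0 i != 0.
    apply/existsP; apply: contraR v0; rewrite negb_exists => /forallP v0.
    by apply/eqP/rowP => i; rewrite mxE; apply/eqP/negPn.
  rewrite (bigD1 (enum_val i)) //= ltr_pwDl ?sumr_ge0 //.
  by rewrite normr_gt0 /w enum_valK.
exists (fun x => `|w x| / \sum_y `|w y|); split; first split.
- by move=> x; rewrite divr_ge0 // ltW.
- by rewrite -mulr_suml divff // gt_eqF.
- move=> y; rewrite mulrAC -(balanced_norm q0 bal) mulr_suml.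
  by apply: eq_bigr => x _; rewrite mulrAC.
Qed.

Lemma balanced_symmetry q nu (s : S -> S) : injective s ->
  (forall x y, q (s x) (s y) = q x y) -> balanced q nu -> balanced q (nu \o s).
Proof.
move=> s_inj qs bal y.
transitivity (\sum_x nu (s x) * q (s x) (s y)).
  by apply: eq_bigr => x _; rewrite qs.
rewrite -(reindex_inj s_inj (P := xpredT) (F := fun z => nu z * q z (s y))) bal /=.
by rewrite (reindex_inj s_inj); congr (_ * _); apply: eq_bigr => z _; rewrite qs.
Qed.

Lemma is_law_comp nu (s : S -> S) : injective s -> is_law nu -> is_law (nu \o s).
Proof.
move=> s_inj [nu0 sum1]; split=> [x|]; first exact: nu0.
by rewrite -sum1 [RHS](reindex_inj s_inj).
Qed.

End JumpChains.

(** * Configurations of particles on the cycle *)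

Lemma Zp_pred_val (K : nat) (i : 'Z_K) : (1 < K)%N -> i != 0 -> (i - 1 : 'Z_K) = i.-1 :> nat.
Proof.
move=> K1 i0; have i_gt0 : (0 < i)%N by rewrite lt0n.
have -> : i - 1 = (i.-1)%:R by rewrite -{1}[i]natr_Zp -{1}(prednK i_gt0) -natr1 addrK.
rewrite val_Zp_nat // modn_small // (leq_ltn_trans (leq_pred _)) //.
by rewrite -[X in (_ < X)%N](Zp_cast K1).
Qed.

Lemma natr_Zp_neq0 (K n : nat) : (1 < K)%N -> (0 < n < K)%N -> n%:R != 0 :> 'Z_K.
Proof.
move=> K1 /andP[n0 nK]; rewrite -val_eqE /= val_Zp_nat // modn_small //.
by rewrite -lt0n.
Qed.

Lemma Zp_shift_invariant (K : nat) (T : Type) (F : 'Z_K -> T) :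
  (forall k, F (k + 1) = F k) -> forall k, F k = F 0.
Proof.
move=> FS k; rewrite -[k]natr_Zp; elim: (k : nat) => [|n IH] //.
by rewrite -addn1 natrD FS.
Qed.

Lemma Z3_neighbours (K : nat) (i j : 'Z_K) :
  K = 3%N -> i != j -> j = i + 1 \/ i = j + 1.
Proof.
move=> K_eq; move: i j; rewrite K_eq => i j.
by case: i => [[|[|[|]]] // ?]; case: j => [[|[|[|]]] // ?] // _;
  (left; apply/eqP; done) || (right; apply/eqP; done).
Qed.

Section Configurations.
Variables K N : nat.
Implicit Types (x y eta : conf K N) (i j k : 'Z_K).

Lemma conf_ext x y : (forall k, x k = y k) -> x = y.
Proof. by move=> xy; apply/val_inj/ffunP. Qed.

Lemma jump_target x i j : (0 < x i)%N -> (0 < jump i j x j)%N.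
Proof. by move=> xi; rewrite jumpE // eqxx addn1. Qed.

Lemma jumpK x i j : (0 < x i)%N -> jump j i (jump i j x) = x.
Proof.
move=> xi; apply: conf_ext => k; rewrite jumpE ?jump_target // jumpE //.
by case: (k =P i) => [->|_]; case: (_ =P j) => _ /=; lia.
Qed.

(** The displacement of one particle between distinct sites determines both
sites, since the occupation drops only at the source and rises only at the
target. *)
Lemma jump_inj x i j i' j' : (0 < x i)%N -> (0 < x i')%N -> i != j ->
  jump i j x = jump i' j' x -> i' = i /\ j' = j.
Proof.
move=> xi xi' /eqP ij E.
have Ei : jump i j x i = jump i' j' x i by rewrite E.
have Ej : jump i j x j = jump i' j' x j by rewrite E.
move: Ei Ej; rewrite !jumpE // !eqxx.
rewrite (introF eqP ij) (introF eqP (nesym ij)).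
case: (i =P i') => [<-|_] /=; last by case: (i == j') => /=; lia.
case: (j =P j') => [<- //|_] /=.
by case: (j == i) => /=; lia.
Qed.

Lemma packed_subproof : (\sum_(k : 'Z_K) [ffun k : 'Z_K => (k == 0%R) * N] k == N)%N.
Proof.
rewrite (bigD1 (0%R : 'Z_K)) //= ffunE eqxx mul1n big1 ?addn0 // => k /negPf k0.
by rewrite ffunE k0.
Qed.

Definition packed : conf K N := Conf packed_subproof.

Lemma packedE k : packed k = ((k == 0%R) * N)%N.
Proof. by rewrite ffunE. Qed.

(** Total distance of the particles to the site 0 along downward steps: the
measure of the induction in [fv_irreducible]. *)
Definition height eta : nat := (\sum_(k : 'Z_K) k * eta k)%N.

Lemma height_jump eta i : (1 < K)%N -> (0 < eta i)%N -> i != 0 ->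
  height eta = (height (jump i (i - 1) eta)).+1.
Proof.
move=> K1 eta_i i0; have i1 : i - 1 != i.
  by rewrite -subr_eq0 addrAC subrr add0r oppr_eq0 oner_eq0.
have := Zp_pred_val K1 i0; move: (i - 1) i1 => j ji jE; rewrite /height.
rewrite (bigD1 i) // [in RHS](bigD1 i) //=.
rewrite (bigD1 j) // [in RHS](bigD1 j) //=.
rewrite !jumpE // !eqxx (negPf ji) [i == j]eq_sym (negPf ji) jE.
rewrite [X in (_ + (_ + X) = _)%N](_ : _ =
  \sum_(k < _ | (k != i) && (k != j)) k * jump i j eta k)%N.
  have : (0 < i)%N by rewrite lt0n.
  rewrite /= !subn0 !addn0 subn1 addn1; set s := (\sum_(k < _ | _) _)%N.
  case: (nat_of_ord i) => // m _; case: (eta i) eta_i => // a _ /=.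
  by rewrite !mulSn !mulnS; lia.
apply: eq_bigr => k /andP[ki kj].
by rewrite jumpE // (negPf ki) (negPf kj) subn0 addn0.
Qed.

Lemma height_eq0 eta : height eta = 0%N -> eta = packed.
Proof.
move=> /eqP; rewrite /height sum_nat_eq0 => /forallP eta0.
have eta_out k : k != 0 -> eta k = 0%N.
  move=> k0; have := eta0 k; rewrite muln_eq0 => /orP[|/eqP //].
  by move/negPf: k0; rewrite -val_eqE /= => ->.
apply: conf_ext => k; rewrite packedE; have [->|/eta_out -> //] := eqVneq k 0.
by rewrite mul1n -[RHS](eqP (occupation_sum eta)) (bigD1 0) //= big1 ?addn0.
Qed.

Lemma rotationE x k : @rotation K N x k = x (k + 1).
Proof. by rewrite ffunE. Qed.

Lemma rotation_inj : injective (@rotation K N).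
Proof.
move=> x y xy; apply: conf_ext => k.
by rewrite -[k](subrK 1) -!rotationE xy.
Qed.

Lemma rotation_jump x i j : (0 < x (i + 1)%R)%N ->
  jump i j (rotation x) = rotation (jump (i + 1) (j + 1) x).
Proof.
move=> xi; apply: conf_ext => k.
by rewrite jumpE ?rotationE // jumpE // !(inj_eq (addIr (1 : 'Z_K))).
Qed.

End Configurations.

(** * The Fleming-Viot particle system *)

Section FlemingViotProcess.
Variables (R : realType) (K N : nat) (theta p : R).
Implicit Types (x y eta : conf K N) (i j k : 'Z_K).

Definition jump_rate i j eta : R :=
  (eta i)%:R *
    ((j == i + 1)%:R + theta * (j == i - 1)%:R + p * ((eta j)%:R / (N%:R - 1))).

Definition fv_intensity eta eta' : R :=
  \sum_i \sum_j jump_rate i j eta * (jump i j eta == eta')%:R.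

Lemma generatorE : generator theta p = jump_generator fv_intensity.
Proof.
apply/funext => f; apply/funext => eta; rewrite /jump_generator.
under [RHS]eq_bigr do rewrite mulr_suml.
rewrite exchange_big; apply: eq_bigr => i _ /=.
under [RHS]eq_bigr do rewrite mulr_suml.
rewrite exchange_big; apply: eq_bigr => j _ /=.
under eq_bigr do rewrite -mulrA.
by rewrite -mulr_sumr (sum_delta _ (fun z => f z - f eta)).
Qed.

Hypotheses (K3 : (3 <= K)%N) (N2 : (2 <= N)%N) (theta0 : 0 < theta) (p0 : 0 < p).

Let N1 : 0 < N%:R - 1 :> R.
Proof. by rewrite subr_gt0 ltr1n. Qed.

Let K1 : (1 < K)%N. Proof. exact: ltnW. Qed.

Let pull_ge0 (n : nat) : 0 <= p * (n%:R / (N%:R - 1)).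
Proof. by rewrite mulr_ge0 ?(ltW p0) // divr_ge0 // ltW. Qed.

Let natZ2_neq0 : 1 + 1 != 0 :> 'Z_K.
Proof. exact: (natr_Zp_neq0 (n := 2)). Qed.

Lemma jump_rate_ge0 i j eta : 0 <= jump_rate i j eta.
Proof.
apply: mulr_ge0 => //; apply: addr_ge0 => //.
by rewrite addr_ge0 // mulr_ge0 // ltW.
Qed.

Lemma fv_intensity_ge0 x y : 0 <= fv_intensity x y.
Proof.
by apply: sumr_ge0 => i _; apply: sumr_ge0 => j _; rewrite mulr_ge0 // jump_rate_ge0.
Qed.

(** Several pairs of sites could contribute to the rate between two
configurations; [jump_inj] leaves only one of them. *)
Lemma fv_intensity_jump x i j : (0 < x i)%N -> i != j ->
  fv_intensity x (jump i j x) = jump_rate i j x.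
Proof.
move=> xi ij; rewrite /fv_intensity (bigD1 i) //= (bigD1 j) //= eqxx mulr1.
have other i' j' : (i' != i) || (j' != j) ->
    jump_rate i' j' x * (jump i' j' x == jump i j x)%:R = 0.
  move=> ne; have [xi'|] := posnP (x i'); first by rewrite /jump_rate xi' !mul0r.
  move=> xi'; case: eqP => [/esym E|_]; last by rewrite mulr0.
  by have [ii jj] := jump_inj xi xi' ij E; rewrite ii jj !eqxx in ne.
rewrite big1 ?addr0 => [|j' jj]; last by rewrite other // jj orbT.
rewrite big1 ?addr0 // => i' ii; apply: big1 => j' _.
by rewrite other // ii.
Qed.

Lemma fv_intensity_back x i j : (0 < x i)%N -> i != j ->
  fv_intensity (jump i j x) x = jump_rate j i (jump i j x).
Proof.
move=> xi ij; rewrite -{2}(jumpK j xi).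
by rewrite fv_intensity_jump ?jump_target // eq_sym.
Qed.

(** Downward steps have rate at least [theta] and the steps undoing them have
rate at least 1, so a set closed under predecessors contains a configuration
iff it contains the packed one. *)
Lemma fv_irreducible : irreducible fv_intensity.
Proof.
move=> P [x0 Px0] closed.
have dec1 i : i != i - 1.
  by rewrite -subr_eq0 opprB addrCA subrr addr0 oner_eq0.
have rate_pos i eta : (0 < eta i)%N -> 0 < jump_rate i (i - 1) eta.
  move=> eta_i; rewrite mulr_gt0 ?ltr0n // eqxx mulr1.
  by apply: ltr_wpDr => //; apply: ltr_wpDl.
have step eta i : (0 < eta i)%N -> P eta <-> P (jump i (i - 1) eta).
  move=> eta_i; split; apply: closed.
    rewrite fv_intensity_back //; rewrite mulr_gt0 ?ltr0n ?jump_target //.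
    rewrite subrK eqxx -addrA; apply: ltr_pwDl => //; apply: addr_ge0 => //.
    by rewrite mulr_ge0 // ltW.
  by rewrite fv_intensity_jump // rate_pos.
have packedP eta : P eta <-> P (packed K N).
  have [n] := ubnP (height eta); elim: n eta => // n IH eta eta_n.
  have [/height_eq0 -> //|] := posnP (height eta).
  rewrite lt0n /height sum_nat_eq0 negb_forall => /existsP[i] /=.
  rewrite muln_eq0 negb_or => /andP[i0 eta_i].
  rewrite (step eta i) ?lt0n // IH // -ltnS -height_jump ?lt0n //.
by move=> x; apply/packedP/(packedP x0).
Qed.

Lemma jump_rate_rotation x i j :
  jump_rate i j (rotation x) = jump_rate (i + 1) (j + 1) x.
Proof.
rewrite /jump_rate !rotationE (inj_eq (addIr (1 : 'Z_K))).
by rewrite [i + 1 - 1]addrAC (inj_eq (addIr (1 : 'Z_K))).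
Qed.

(** The rates depend on the sites only through their differences. *)
Lemma fv_intensity_rotation x y :
  fv_intensity (rotation x) (rotation y) = fv_intensity x y.
Proof.
rewrite /fv_intensity [RHS](reindex_inj (addIr (1 : 'Z_K))) /=; apply: eq_bigr => i _.
rewrite [RHS](reindex_inj (addIr (1 : 'Z_K))) /=; apply: eq_bigr => j _.
rewrite jump_rate_rotation; have [xi|xi] := posnP (x (i + 1)).
  by rewrite /jump_rate xi !mul0r.
by rewrite rotation_jump // (inj_eq (@rotation_inj _ _)).
Qed.

Lemma rotation_invariant_mean (nu : conf K N -> R) :
  is_law nu -> (forall x, nu (rotation x) = nu x) ->
  forall k, mean nu (fun eta => empirical R eta k) = K%:R^-1.
Proof.
move=> [_ sum1] rot k.
pose m k := mean nu (fun eta => empirical R eta k).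
have mS l : m (l + 1) = m l.
  rewrite /m /mean [RHS](reindex_inj (@rotation_inj _ _)) /=.
  by apply: eq_bigr => x _; rewrite rot /empirical rotationE.
have m_sum : \sum_l m l = 1.
  rewrite exchange_big -[RHS]sum1 /=; apply: eq_bigr => x _.
  rewrite -mulr_sumr -mulr_suml -natr_sum (eqP (occupation_sum x)).
  by rewrite divff ?mulr1 // pnatr_eq0 -lt0n ltnW.
have K0 : K%:R != 0 :> R by rewrite pnatr_eq0 -lt0n (ltn_trans _ K3).
rewrite -/(m k); apply: (mulfI K0); rewrite divff // -[RHS]m_sum.
rewrite (eq_bigr (fun=> m k)) => [|l _]; last by rewrite !(Zp_shift_invariant mS).
by rewrite sumr_const card_ord Zp_cast // mulr_natl.
Qed.

Lemma fv_stationary_pos (nu : conf K N -> R) x :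
  is_law nu -> balanced fv_intensity nu -> 0 < nu x.
Proof.
move=> [nu0 sum1] bal; rewrite lt_neqAle nu0 andbT eq_sym; apply/eqP => nux.
have nu_eq0 := balanced_eq0 fv_intensity_ge0 fv_irreducible nu0 bal nux.
by move: sum1; rewrite big1 // => /esym/eqP; rewrite oner_eq0.
Qed.

(** When [K >= 4] the site 2 differs from both neighbours 1 and -1 of the site
0; from the packed configuration the rate of a jump from 0 to 2 is zero, as 2
is empty, whereas the reverse jump has a positive rate. *)
Lemma detailed_balance_eq3 (nu : conf K N -> R) :
  is_law nu -> detailed_balance fv_intensity nu -> K = 3%N.
Proof.
move=> law db; apply/eqP; rewrite eqn_leq K3 andbT leqNgt; apply/negP => K4.
have z2 : 2%:R != 0 :> 'Z_K by apply: natr_Zp_neq0; lia.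
have z21 : 2%:R != 0 + 1 :> 'Z_K.
  by rewrite add0r -subr_eq0 -(natr1 1) addrK natr_Zp_neq0 //; lia.
have z2m : 2%:R != 0 - 1 :> 'Z_K.
  by rewrite sub0r -addr_eq0 natr1 natr_Zp_neq0 //; lia.
pose c0 := packed K N.
have c00 : (0 < c0 0%R)%N by rewrite packedE eqxx mul1n ltnW.
have z02 : 0 != 2%:R :> 'Z_K by rewrite eq_sym.
have no_way : jump_rate 0 2%:R c0 = 0.
  by rewrite /jump_rate !packedE (negPf z21) (negPf z2m) (negPf z2) mul0n mul0r !mulr0 !addr0 mulr0.
have := db c0 (jump 0 2%:R c0).
rewrite fv_intensity_jump // fv_intensity_back // no_way mulr0 /jump_rate.
have cpos := fv_stationary_pos (jump 0 2%:R c0) law (detailed_balance_balanced db).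
apply/eqP; rewrite eq_sym gt_eqF // mulr_gt0 // mulr_gt0 ?ltr0n ?jump_target //.
apply: ltr_wpDl; first by rewrite addr_ge0 // mulr_ge0 // ltW.
apply: mulr_gt0 => //; apply: divr_gt0 => //.
by rewrite ltr0n jumpE // packedE eqxx (negPf z02); lia.
Qed.

(** For [K >= 3] two sites cannot be neighbours in both directions, so only one
of the two indicators in the rate is 1. *)
Lemma jump_rate_up i j x : j = i + 1 ->
  jump_rate i j x = (x i)%:R * (1 + p * ((x j)%:R / (N%:R - 1))).
Proof.
move=> ->; rewrite /jump_rate eqxx (inj_eq (addrI i)) -addr_eq0.
by rewrite (negPf natZ2_neq0) mulr0 addr0.
Qed.

Lemma jump_rate_down i j x : j = i + 1 ->
  jump_rate j i x = (x j)%:R * (theta + p * ((x i)%:R / (N%:R - 1))).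
Proof.
move=> ->; rewrite /jump_rate addrK eqxx mulr1.
have /negPf-> : i != i + 1 + 1; last by rewrite add0r.
by rewrite -addrA -[X in X != _]addr0 (inj_eq (addrI i)) eq_sym.
Qed.

(** Kolmogorov's criterion on the cycle [c0], [a], [b] of configurations in
which at most one particle has left the site 0, sitting at 1 in [a] and at
[-1 = 2] in [b]. *)
Lemma detailed_balance_theta1 (nu : conf K N -> R) :
  is_law nu -> detailed_balance fv_intensity nu -> K = 3%N -> theta = 1.
Proof.
move=> law db K_eq.
have m1 : - 1 = 1 + 1 :> 'Z_K by rewrite K_eq; apply/eqP.
have o0 : 1 != 0 :> 'Z_K by exact: oner_neq0.
have m0 : - 1 != 0 :> 'Z_K by rewrite oppr_eq0.
have m1' : - 1 != 1 :> 'Z_K by rewrite K_eq.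
pose c0 := packed K N; pose a := jump 0 1 c0; pose b := jump 0 (- 1) c0.
have c00 : (0 < c0 0%R)%N by rewrite packedE eqxx mul1n ltnW.
have a1 : (0 < a 1%R)%N by exact: jump_target.
have bE : jump 1 (- 1) a = b.
  apply: conf_ext => k; rewrite (jumpE _ a1) !(jumpE _ c00) packedE.
  by case: (k =P 0) => [->|_];
    rewrite ?[0 == _]eq_sym ?(negPf o0) ?(negPf m0) /= ?addnK ?addn0 ?subn0.
have aE k : a k = ((k == 0%R) * N - (k == 0%R) + (k == 1%R))%N.
  by rewrite jumpE // packedE.
have bvalE k : b k = ((k == 0%R) * N - (k == 0%R) + (k == (-1)%R))%N.
  by rewrite jumpE // packedE.
have ne_sym (u v : 'Z_K) : u != v -> v != u by rewrite eq_sym.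
have s0 : 1 = 0 + 1 :> 'Z_K by rewrite add0r.
have s2 : 0 = - 1 + 1 :> 'Z_K by rewrite addNr.
have N1E : ((N - 1 + 0)%:R : R) / (N%:R - 1) = 1.
  by rewrite addn0 natrB ?divff ?gt_eqF // ltnW.
have E01 := db c0 a.
rewrite (fv_intensity_jump c00 (ne_sym _ _ o0)) (fv_intensity_back c00 (ne_sym _ _ o0)) in E01.
have E12 := db a (jump 1 (- 1) a).
rewrite (fv_intensity_jump a1 (ne_sym _ _ m1')) (fv_intensity_back a1 (ne_sym _ _ m1')) bE in E12.
have E02 := db c0 b.
rewrite (fv_intensity_jump c00 (ne_sym _ _ m0)) (fv_intensity_back c00 (ne_sym _ _ m0)) in E02.
rewrite (jump_rate_up _ s0) (jump_rate_down _ s0) in E01.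
rewrite (jump_rate_up _ m1) (jump_rate_down _ m1) in E12.
rewrite (jump_rate_up _ s2) (jump_rate_down _ s2) in E02.
rewrite !packedE !aE !bvalE in E01 E12 E02.
have z1 : (0 == 1 :> 'Z_K) = false by rewrite eq_sym (negPf o0).
have zm1 : (0 == - 1 :> 'Z_K) = false by rewrite eq_sym (negPf m0).
have om1 : (1 == - 1 :> 'Z_K) = false by rewrite eq_sym (negPf m1').
rewrite !eqxx (negPf o0) (negPf m0) ?(negPf m1') z1 ?zm1 ?om1 /= in E01 E12 E02.
rewrite !mul1n !mul0n !subn0 !add0n N1E mul0r mulr0 mulr1 addr0 in E01 E12 E02.
have nub : 0 < nu b := fv_stationary_pos b law (detailed_balance_balanced db).
(* Eliminating [nu c0] and [nu a] between the three balance equations gives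
   [theta^2 (theta + p) = 1 + p]; the difference of the two sides factors
   through [theta - 1]. *)
have : nu b * ((theta - 1) * (theta ^+ 2 + theta + 1 + p * theta + p)) = 0.
rewrite (_ : _ * _ = (nu b * (1 * (theta + 0))) * (theta + p) * theta
    - nu b * (1 * (1 + p))); last by ring.
  rewrite -E12 -E02.
  rewrite (_ : _ - _ = theta * (nu a * (1 * (theta + p)) - nu c0 * (N%:R * 1))); last by ring.
  by rewrite -E01 subrr mulr0.
move/eqP; rewrite !mulf_eq0 (gt_eqF nub) /= subr_eq0 => /orP[/eqP //|].
by rewrite gt_eqF // ltr_wpDl // !addr_ge0 ?mulr_ge0 ?exprn_ge0 // ltW.
Qed.

(** Chosen so that [site_weight n.+1 / site_weight n] is the rate at which a
particle is attracted by a site with [n] particles, divided by the number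
[n.+1] of particles that may then leave it. *)
Definition site_weight (n : nat) : R :=
  (\prod_(m < n) (1 + p * (m%:R / (N%:R - 1)))) / n`!%:R.

Definition product_weight eta : R := \prod_k site_weight (eta k).

Lemma site_weightS n :
  site_weight n.+1 * n.+1%:R = site_weight n * (1 + p * (n%:R / (N%:R - 1))).
Proof.
rewrite /site_weight big_ord_recr /= factS natrM.
have f0 : n`!%:R != 0 :> R by rewrite pnatr_eq0 -lt0n fact_gt0.
have n0 : n.+1%:R != 0 :> R by rewrite pnatr_eq0.
set P := \prod_(m < n) _; set c := 1 + _.
by move: (n.+1%:R : R) (n`!%:R : R) n0 f0 => m f m0 f0; field; rewrite m0 f0.
Qed.

Lemma product_weight_gt0 eta : 0 < product_weight eta.
Proof.
apply: prodr_gt0 => k _; apply: divr_gt0; last by rewrite ltr0n fact_gt0.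
by apply: prodr_gt0 => m _; apply: ltr_pwDl.
Qed.

(** On the triangle with [theta = 1] all pairs of distinct sites are alike.  By
[site_weightS] both sides equal the weight of the particles common to [x] and
its successor, times the attractions of the sites [i] and [j] holding those
particles only. *)
Lemma product_weight_jump x i j : K = 3%N -> theta = 1 -> (0 < x i)%N -> i != j ->
  product_weight x * jump_rate i j x =
  product_weight (jump i j x) * jump_rate j i (jump i j x).
Proof.
move=> K_eq th1 xi ij.
have rateE u v y : u != v -> jump_rate u v y = (y u)%:R * (1 + p * ((y v)%:R / (N%:R - 1))).
  move=> uv; have [uvE|vuE] := Z3_neighbours K_eq uv; first exact: jump_rate_up.
  by rewrite jump_rate_down // th1.
have ji : j != i by rewrite eq_sym.
rewrite !rateE // /product_weight.
rewrite (bigD1 i) // (bigD1 j) //= [in RHS](bigD1 i) // [in RHS](bigD1 j) //=.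
rewrite !jumpE // !eqxx (negPf ij) (negPf ji) /= !subn0 !addn0 subn1 addn1.
rewrite [in RHS](eq_bigr (fun k => site_weight (x k))); last first.
  by move=> k /andP[ki kj]; rewrite jumpE // (negPf ki) (negPf kj) subn0 addn0.
case: (x i) xi => // a _ /=; set b := x j; set W := \prod_(k < _ | _) _.
have := site_weightS a; have := site_weightS b.
set Wa := site_weight a.+1; set Wb := site_weight b.+1.
set ca := 1 + p * (a%:R / _); set cb := 1 + p * (b%:R / _) => Eb Ea.
transitivity ((Wa * a.+1%:R) * (site_weight b * cb) * W); first by ring.
by rewrite -Eb Ea; ring.
Qed.

Lemma product_weight_detailed_balance : K = 3%N -> theta = 1 ->
  detailed_balance fv_intensity product_weight.
Proof.
move=> K_eq th1 x y; rewrite /fv_intensity !mulr_sumr.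
under eq_bigr do rewrite mulr_sumr.
under [RHS]eq_bigr do rewrite mulr_sumr.
rewrite [RHS]exchange_big /=; apply: eq_bigr => i _; apply: eq_bigr => j _.
(* A jump from [i] to [j] taking [x] to [y] is matched with the jump from [j]
   to [i] taking [y] back to [x]. *)
have forward u v (z w : conf K N) : (0 < z u)%N -> jump u v z = w ->
    product_weight z * (jump_rate u v z * (jump u v z == w)%:R) =
    product_weight w * (jump_rate v u w * (jump v u w == z)%:R).
  move=> zu <-; rewrite jumpK // !eqxx !mulr1.
  have [<-|uv] := eqVneq u v; last exact: product_weight_jump.
  have -> // : jump u u z = z.
  by apply: conf_ext => k; rewrite jumpE //; case: eqP => [->|] /=; lia.
have [/andP[xi /eqP xy]|no_xy] := boolP ((0 < x i)%N && (jump i j x == y)).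
  exact: forward.
have [/andP[yj /eqP yx]|no_yx] := boolP ((0 < y j)%N && (jump j i y == x)).
  by apply/esym; exact: forward.
have zero u v (z w : conf K N) : ~~ ((0 < z u)%N && (jump u v z == w)) ->
    jump_rate u v z * (jump u v z == w)%:R = 0.
  rewrite negb_and -leqNgt leqn0 => /orP[/eqP zu|/negPf->]; last by rewrite mulr0.
  by rewrite /jump_rate zu !mul0r.
by rewrite !zero // !mulr0.
Qed.

Lemma fv_reversible : K = 3%N -> theta = 1 ->
  exists nu, is_law nu /\ detailed_balance fv_intensity nu.
Proof.
move=> K_eq th1; pose Z := \sum_x product_weight x.
have Z0 : 0 < Z.
  rewrite /Z (bigD1 (packed K N)) //= ltr_pwDl ?product_weight_gt0 //.
  by apply: sumr_ge0 => x _; rewrite ltW // product_weight_gt0.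
exists (fun x => product_weight x / Z); split; first split.
- by move=> x; rewrite divr_ge0 // ltW // product_weight_gt0.
- by rewrite -mulr_suml divff // gt_eqF.
- by move=> x y; rewrite mulrAC product_weight_detailed_balance // mulrAC.
Qed.

End FlemingViotProcess.

(** * The killed walk on the cycle *)

Section KilledWalk.
Variables (R : realType) (K : nat) (theta p : R).
Implicit Types (mu : 'Z_K -> R) (f : option 'Z_K -> R).

(** The walk without killing. *)
Definition walk_intensity (i j : 'Z_K) : R :=
  (i + 1 == j)%:R + theta * (i - 1 == j)%:R.

Definition killed_intensity (x z : option 'Z_K) : R :=
  if x is Some i then
    (Some (i + 1) == z)%:R + theta * (Some (i - 1) == z)%:R + p * (None == z)%:R
  else 0.

Lemma killed_walkE : killed_walk theta p = jump_generator killed_intensity.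
Proof.
apply/funext => f; apply/funext => -[i|]; rewrite /jump_generator /=; last first.
  by rewrite big1 // => z _; rewrite mul0r.
under eq_bigr do rewrite !mulrDl -!mulrA.
rewrite !big_split /= -!mulr_sumr.
by rewrite !(sum_delta _ (fun z => f z - f (Some i))).
Qed.

Lemma walk_generatorE (g : 'Z_K -> R) i :
  jump_generator walk_intensity g i = (g (i + 1) - g i) + theta * (g (i - 1) - g i).
Proof.
rewrite /jump_generator.
under eq_bigr do rewrite mulrDl -mulrA.
rewrite big_split /= -mulr_sumr.
by rewrite !(sum_delta _ (fun z => g z - g i)).
Qed.

(** Killing at a constant rate only adds the term [- p], because [f] vanishes at
the cemetery. *)
Lemma mean_killed_walk mu f : f None = 0 ->
  mean mu (fun y => killed_walk theta p f (Some y)) =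
  mean mu (jump_generator walk_intensity (f \o some)) - p * mean mu (f \o some).
Proof.
move=> f0; rewrite /mean mulr_sumr -sumrB; apply: eq_bigr => i _.
by rewrite walk_generatorE /= f0; ring.
Qed.

(** Upward steps alone lead from each site to any other. *)
Lemma walk_irreducible : 0 <= theta -> irreducible walk_intensity.
Proof.
move=> theta_ge0 P [y Py] closed x.
have step n : P (y - n%:R).
  elim: n => [|n IH]; first by rewrite subr0.
  apply: closed IH; rewrite -natr1 opprD addrA /walk_intensity subrK eqxx.
  by rewrite ltr_pwDl // mulr_ge0.
have := step (y - x : 'Z_K).
by rewrite natr_Zp opprB addrC subrK.
Qed.

(** Under equal weights balance asks that the total rates into and out of each
site agree; both are [1 + theta]. *)
Lemma balanced_uniform : balanced walk_intensity (@uniform_law R K).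
Proof.
move=> y; rewrite -mulr_sumr; congr (_ * _); rewrite !big_split /= -!mulr_sumr.
have count (h : 'Z_K -> 'Z_K) : injective h -> \sum_x (h x == y)%:R = 1 :> R.
  move=> h_inj; rewrite -(reindex_inj h_inj (P := xpredT) (F := fun z => (z == y)%:R)) /=.
  by rewrite (bigD1 y) //= eqxx big1 ?addr0 // => z /negPf->.
have count1 (a : 'Z_K) : \sum_z (a == z)%:R = 1 :> R.
  by rewrite (bigD1 a) //= eqxx big1 ?addr0 // => z; rewrite eq_sym => /negPf->.
by rewrite !count1 !count //; exact: addIr.
Qed.

Lemma uniform_law_is_law : (1 < K)%N -> is_law (@uniform_law R K).
Proof.
move=> K1; split=> [x|]; first by rewrite invr_ge0.
rewrite sumr_const card_ord Zp_cast // -[LHS]mulr_natl divff //.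
by rewrite pnatr_eq0 -lt0n ltnW.
Qed.

Lemma killed_walk_alive k (z : option 'Z_K) :
  iter k (killed_walk theta p) (fun z => (z != None)%:R) z =
  (- p) ^+ k * (z != None)%:R.
Proof.
elim: k z => [|k IH] z; first by rewrite mul1r.
rewrite iterS (_ : iter k _ _ = fun z => (- p) ^+ k * (z != None)%:R); last exact/funext.
by case: z => [i|] /=; rewrite exprS; ring.
Qed.

Lemma killed_walk_dead k f : f None = 0 -> iter k (killed_walk theta p) f None = 0.
Proof. by case: k. Qed.

(** Hence a law balanced for the walk is an eigenvector of the killed walk for
the eigenvalue [- p]. *)
Lemma mean_iter_killed_walk mu k f : balanced walk_intensity mu -> f None = 0 ->
  mean mu (fun y => iter k (killed_walk theta p) f (Some y)) =
  (- p) ^+ k * mean mu (f \o some).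
Proof.
move=> /balancedP bal f0; elim: k => [|k IH]; first by rewrite mul1r.
rewrite exprS -mulrA -IH mulNr -[RHS]add0r -(bal (iter k (killed_walk theta p) f \o some)).
by rewrite iterS mean_killed_walk // killed_walk_dead.
Qed.

Lemma mean_killed_semigroup mu f t :
  mean mu (fun y => semigroup (killed_walk theta p) t f (Some y)) =
  egf (fun k => mean mu (fun y => iter k (killed_walk theta p) f (Some y))) t.
Proof.
rewrite killed_walkE.
exact: (egf_sum mu t (fun x => geometric_growth_iter killed_intensity f (Some x))).
Qed.

Lemma mean_indicator mu x :
  mean mu ((fun z => (z == Some x)%:R) \o some) = mu x.
Proof.
rewrite /mean (bigD1 x) //= eqxx mulr1 big1 ?addr0 // => y yx.
by rewrite (inj_eq Some_inj) (negPf yx) mulr0.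
Qed.

Lemma survival_probability mu t : is_law mu ->
  mean mu (fun y => semigroup (killed_walk theta p) t (fun z => (z != None)%:R) (Some y))
  = expR (t * - p).
Proof.
move=> [_ sum1]; rewrite mean_killed_semigroup -[RHS]mulr1 -egfX.
congr (egf _ t); apply/funext => k; rewrite /mean.
under eq_bigr do rewrite killed_walk_alive mulr1.
by rewrite -mulr_suml sum1 mul1r mulr1.
Qed.

(** Survival has probability [expR (- p t)] whatever the starting law, so
quasi-stationarity says that the mass at [x] is [expR (- p t) * mu x]; its
coefficient of order one in [t] is the balance of flows at [x]. *)
Lemma quasi_stationary_balanced mu :
  quasi_stationary (killed_walk theta p) mu <-> is_law mu /\ balanced walk_intensity mu.
Proof.
split=> -[law qs]; split => //; last first.
  move=> t x t0; rewrite survival_probability // mean_killed_semigroup.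
  under [X in egf X](_ : _ = fun k => (- p) ^+ k * mu x).
    by apply/funext => k; rewrite mean_iter_killed_walk // mean_indicator.
  by rewrite egfX mulrAC divff ?mul1r // gt_eqF // expR_gt0.
apply: balanced_indicator => x.
have grow : geometric_growth (fun k => mean mu (fun y =>
    iter k (killed_walk theta p) (fun z => (z == Some x)%:R) (Some y))).
  rewrite killed_walkE; apply: (geometric_growth_sum mu) => y.
  exact: geometric_growth_iter.
have coef1 : mean mu (fun y => killed_walk theta p (fun z => (z == Some x)%:R) (Some y)) =
    (- p) ^+ 1 * mu x.
  apply: (egf_coef1 grow (geometric_growthX (- p) (mu x))) => t t0.
  rewrite -mean_killed_semigroup egfX -(qs t x t0) survival_probability //.
  by rewrite mulrC divfK // gt_eqF // expR_gt0.
rewrite mean_killed_walk // mean_indicator expr1 mulNr in coef1.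
by move/eqP: coef1; rewrite -subr_eq0 opprK subrK => /eqP.
Qed.

End KilledWalk.

Theorem theorem1p2 (R : realType) (K N : nat) (theta p : R) :
  (3 <= K)%N -> (2 <= N)%N -> 0 < theta -> 0 < p ->
  (* (a) *)
  (reversible (@generator R K N theta p) <-> K = 3%N /\ theta = 1) /\
  (exists nu : conf K N -> R,
    [/\ (* nu is the unique stationary distribution *)
        stationary (generator theta p) nu,
        forall nu' : conf K N -> R,
          stationary (generator theta p) nu' -> nu' =1 nu,
        (* (b) *)
        forall (l : nat) (eta : conf K N), (1 <= l <= K - 1)%N ->
          nu eta = nu (iter l (@rotation K N) eta)
      & (* (c) *)
        forall k : 'Z_K,
          mean nu (fun eta => empirical R eta k) = uniform_law R k]) /\
  (forall mu : 'Z_K -> R,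
    quasi_stationary (killed_walk theta p) mu <-> mu =1 @uniform_law R K).
Proof.
move=> K3 N2 theta0 p0.
have K1 : (1 < K)%N by exact: ltnW.
have q0 := fv_intensity_ge0 N2 theta0 p0 (K := K).
have irr := fv_irreducible K3 N2 theta0 p0.
split; [|split].
- rewrite generatorE; split => [/reversibleP[nu [law db]]|[K_eq th1]].
    have K_eq := detailed_balance_eq3 K3 N2 theta0 p0 law db.
    by split; last exact: (detailed_balance_theta1 K3 N2 theta0 p0 law db).
  by apply/reversibleP; exact: fv_reversible.
- have [nu [law bal]] := exists_balanced_law (packed K N) q0.
  have uniq nu' : is_law nu' -> balanced (fv_intensity theta p) nu' -> nu' =1 nu.
    by move=> law' bal'; exact: (balanced_law_unique q0 irr).
  have rot x : nu (rotation x) = nu x.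
    apply: (uniq (nu \o @rotation K N)).
      by apply: is_law_comp => //; exact: rotation_inj.
    by apply: balanced_symmetry => //; [exact: rotation_inj | exact: fv_intensity_rotation].
  exists nu; split.
  + by rewrite generatorE; apply/stationaryP.
  + by move=> nu'; rewrite generatorE => /stationaryP[law' bal']; exact: uniq.
  + by move=> l eta _; elim: l => [//|l IH]; rewrite iterS rot.
  + exact: rotation_invariant_mean.
- move=> mu; rewrite quasi_stationary_balanced.
  have unif_law := uniform_law_is_law R K1.
  have unif_bal := @balanced_uniform R K theta.
  split=> [[law bal]|/funext ->]; last by [].
  apply: (balanced_law_unique (q := walk_intensity theta)) => // [x y|].
    by rewrite addr_ge0 // mulr_ge0 // ltW.
  by apply: walk_irreducible; exact: ltW.
Qed.
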